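(* Assume that $N\ge n+1$ and $Y_1^\phi Y_1^{\phi T}\succ 0$, and let $(Q^*,\{P_t^*\}_{t=1}^N)$ be an optimal solution to the problem $$\text{minimize } H(Q,\{P_t\})\quad\text{subject to } (Q,\{P_t\}_{t=1}^N)\in\mathscr{D}.$$ Then $Q^*=\bar Q$, where $\bar Q$ is the true parameter used to generate the data $\{Y_t^\phi\}_{t=2}^N$ with unknown permutations.
   Context: Notation: $\mathbb{S}^n_+$ is the set of symmetric positive semidefinite $n\times n$ real matrices; $G\succeq 0$ (resp. $G\succ 0$) means symmetric positive semidefinite (resp. definite). Standing assumptions: $A\in\mathbb{R}^{n\times n}$ is invertible, $B\in\mathbb{R}^{n\times m}$ has full column rank, $(A,B)$ is controllable, and $\bar Q\in\mathbb{S}^n_+$. Data: there are $M$ agents. For $i=1,\dots,M$, agent $i$ has initial state $x_1^i=\bar x^i\in\mathbb{R}^n$, and $\{x_t^i\}_{t=1}^N$, $\{\bar u_t^i\}_{t=1}^{N-1}$ are the optimal state trajectory and optimal control of the problem of minimizing $x_N^T\bar Qx_N+\sum_{t=1}^{N-1}(x_t^T\bar Qx_t+u_t^Tu_t)$ subject to $x_{t+1}=Ax_t+Bu_t$, $x_1=\bar x^i$. The observations are $Y_t^\phi=[x_t^{\phi_t(1)},\dots,x_t^{\phi_t(M)}]\in\mathbb{R}^{n\times M}$, $t=1,\dots,N$, where $\phi_t$ are unknown permutations of $\{1,\dots,M\}$ (with $\phi_1$ the identity, without loss of generality). Domain: $\mathscr{D}$ is the set of all $(Q,\{P_t\}_{t=1}^N)$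 with $Q\in\mathbb{S}^n_+$, $P_t\in\mathbb{S}^n_+$ for $t=1,\dots,N$, such that $P_N=Q$ and $$\begin{bmatrix}B^TP_{t+1}B+I & B^TP_{t+1}A\\ A^TP_{t+1}B & A^TP_{t+1}A+Q-P_t\end{bmatrix}\succeq 0,\quad t=1,\dots,N-1.$$ Objective: $H:\mathscr{D}\to\mathbb{R}$, $$H(Q,\{P_t\}):=-\mathrm{tr}(P_1Y_1^\phi Y_1^{\phi T})+\mathrm{tr}(P_NY_N^\phi Y_N^{\phi T})+\sum_{t=1}^{N-1}\mathrm{tr}(QY_t^\phi Y_t^{\phi T}).$$ *)

(* Defs.v *)
From HB Require Import structures.
From mathcomp Require Import all_boot all_order all_algebra all_fingroup.
From mathcomp Require Import reals.

Set Implicit Arguments.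
Unset Strict Implicit.
Unset Printing Implicit Defensive.

Import Order.TTheory GRing.Theory Num.Theory.
Local Open Scope ring_scope.

(* Conventions: time-indexed families {z_t} are functions on nat, of which only
   the values at the times named in each definition (at most 1, ..., N) matter;
   in particular nothing is required of, and nothing depends on, z 0. *)

Definition quad (R : realType) (n : nat) (G : 'M[R]_n) (x : 'cV[R]_n) : R :=
  (x^T *m G *m x) 0 0.

Definition psd (R : realType) (n : nat) (G : 'M[R]_n) : Prop :=
  G^T = G /\ forall x : 'cV[R]_n, 0 <= quad G x.

Definition posdef (R : realType) (n : nat) (G : 'M[R]_n) : Prop :=
  G^T = G /\ forall x : 'cV[R]_n, x != 0 -> 0 < quad G x.

(* Kalman rank condition on [B, A B, ..., A^(n-1) B]. *)
Definition controllable (R : realType) (n m : nat)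
    (A : 'M[R]_n) (B : 'M[R]_(n, m)) : Prop :=
  \rank (\mxrow_(k < n) (A ^+ k *m B)) = n.

Definition lqr_feasible (R : realType) (n m N : nat)
    (A : 'M[R]_n) (B : 'M[R]_(n, m)) (x1 : 'cV[R]_n)
    (x : nat -> 'cV[R]_n) (u : nat -> 'cV[R]_m) : Prop :=
  x 1%N = x1 /\
  forall t : nat, (1 <= t < N)%N -> x t.+1 = A *m x t + B *m u t.

Definition lqr_cost (R : realType) (n m N : nat) (Q : 'M[R]_n)
    (x : nat -> 'cV[R]_n) (u : nat -> 'cV[R]_m) : R :=
  quad Q (x N) + \sum_(1 <= t < N) (quad Q (x t) + ((u t)^T *m u t) 0 0).

Definition lqr_optimal (R : realType) (n m N : nat)
    (A : 'M[R]_n) (B : 'M[R]_(n, m)) (Q : 'M[R]_n) (x1 : 'cV[R]_n)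
    (x : nat -> 'cV[R]_n) (u : nat -> 'cV[R]_m) : Prop :=
  lqr_feasible N A B x1 x u /\
  forall (x' : nat -> 'cV[R]_n) (u' : nat -> 'cV[R]_m),
    lqr_feasible N A B x1 x' u' -> lqr_cost N Q x u <= lqr_cost N Q x' u'.

(* Y_t^phi: column j is the state at time t of agent phi_t(j). *)
Definition observations (R : realType) (n M : nat)
    (x : 'I_M -> nat -> 'cV[R]_n) (phi : nat -> 'S_M) (t : nat)
  : 'M[R]_(n, M) :=
  \matrix_(i, j) x (phi t j) t i 0.

Definition lmi_mx (R : realType) (n m : nat)
    (A : 'M[R]_n) (B : 'M[R]_(n, m)) (Q P Pnext : 'M[R]_n) : 'M[R]_(m + n) :=
  block_mx (B^T *m Pnext *m B + 1%:M) (B^T *m Pnext *m A)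
           (A^T *m Pnext *m B)        (A^T *m Pnext *m A + Q - P).

Definition domain (R : realType) (n m N : nat)
    (A : 'M[R]_n) (B : 'M[R]_(n, m))
    (Q : 'M[R]_n) (P : nat -> 'M[R]_n) : Prop :=
  [/\ psd Q,
      forall t : nat, (1 <= t <= N)%N -> psd (P t),
      P N = Q
    & forall t : nat, (1 <= t < N)%N -> psd (lmi_mx A B Q (P t) (P t.+1))].

Definition objective (R : realType) (n M N : nat)
    (Y : nat -> 'M[R]_(n, M)) (Q : 'M[R]_n) (P : nat -> 'M[R]_n) : R :=
  - \tr (P 1%N *m Y 1%N *m (Y 1%N)^T) + \tr (P N *m Y N *m (Y N)^T)
  + \sum_(1 <= t < N) \tr (Q *m Y t *m (Y t)^T).

Definition optimal_solution (R : realType) (n m M N : nat)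
    (A : 'M[R]_n) (B : 'M[R]_(n, m)) (Y : nat -> 'M[R]_(n, M))
    (Q : 'M[R]_n) (P : nat -> 'M[R]_n) : Prop :=
  domain N A B Q P /\
  forall (Q' : 'M[R]_n) (P' : nat -> 'M[R]_n),
    domain N A B Q' P' -> objective N Y Q P <= objective N Y Q' P'.

(* Main.v *)
(** Summing the quadratic form of the LMI along the data telescopes to the LQR
    cost minus [quad (P 1)] of the initial state, so [objective] is bounded below
    by minus the total input energy, which does not involve [(Q, P)].  The Riccati
    solution of the true [Qbar] attains this bound; hence for every minimiser the
    LMI degenerates along the data, i.e. [p t = P t *m x t] satisfies
    [u t = - B^T *m p t.+1] and [p t = A^T *m p t.+1 + Q *m x t].  Subtracting the
    costates of [Qstar] and [Qbar], with [D = Qstar - Qbar], and using that the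
    states at time [N] span the space ([A] is invertible), one gets
    [D *m A ^+ k *m B = 0] for [k <= N - 2], and controllability forces [D = 0]. *)
Require Import Defs.
From mathcomp Require Import all_boot all_order all_algebra all_fingroup.
From mathcomp Require Import reals.
From mathcomp Require Import zify ring lra.

Set Implicit Arguments.
Unset Strict Implicit.
Unset Printing Implicit Defensive.

Import Order.TTheory GRing.Theory Num.Theory.
Local Open Scope ring_scope.

(** * Positive semidefinite quadratic forms *)

Lemma dot_sum_sqr (R : realType) (n : nat) (v : 'cV[R]_n) :
  (v^T *m v) 0 0 = \sum_i v i 0 ^+ 2.
Proof. by rewrite mxE; apply: eq_bigr => i _; rewrite mxE expr2. Qed.

Lemma dot_ge0 (R : realType) (n : nat) (v : 'cV[R]_n) : 0 <= (v^T *m v) 0 0.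
Proof. by rewrite dot_sum_sqr; apply: sumr_ge0 => i _; apply: sqr_ge0. Qed.

Lemma dot_eq0 (R : realType) (n : nat) (v : 'cV[R]_n) :
  (v^T *m v) 0 0 = 0 -> v = 0.
Proof.
rewrite dot_sum_sqr => /eqP; rewrite psumr_eq0; last by move=> i _; apply: sqr_ge0.
move=> /allP v0; apply/colP => i; rewrite mxE.
by have := v0 i (mem_index_enum i); rewrite implyTb sqrf_eq0 => /eqP.
Qed.

Lemma dotC (R : realType) (n : nat) (v w : 'cV[R]_n) :
  (v^T *m w) 0 0 = (w^T *m v) 0 0.
Proof. by rewrite !mxE; apply: eq_bigr => i _; rewrite !mxE mulrC. Qed.

Lemma quadD (R : realType) (n : nat) (G H : 'M[R]_n) (v : 'cV[R]_n) :
  quad (G + H) v = quad G v + quad H v.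
Proof. by rewrite /quad mulmxDr mulmxDl mxE. Qed.

Lemma quad1 (R : realType) (n : nat) (v : 'cV[R]_n) :
  quad 1%:M v = (v^T *m v) 0 0.
Proof. by rewrite /quad mulmx1. Qed.

Lemma quad_congr (R : realType) (n p : nat) (G : 'M[R]_n) (C : 'M[R]_(n, p))
    (v : 'cV[R]_p) :
  quad (C^T *m G *m C) v = quad G (C *m v).
Proof. by rewrite /quad trmx_mul !mulmxA. Qed.

Lemma quad_comb (R : realType) (n : nat) (G : 'M[R]_n) (v w : 'cV[R]_n) (s : R) :
  G^T = G ->
  quad G (v + s *: w) =
    quad G v + 2 * s * (w^T *m (G *m v)) 0 0 + s ^+ 2 * quad G w.
Proof.
move=> symG; rewrite /quad !linearD /= !linearZ /= !mulmxDl -?(scalemxAl, scalemxAr).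
rewrite -!mulmxA !mxE.
have : (v^T *m (G *m w)) 0 0 = (w^T *m (G *m v)) 0 0.
  by rewrite dotC trmx_mul symG mulmxA.
by rewrite !mxE => ->; ring.
Qed.

(** A zero of a nonnegative form is a minimum, so the first-order change along [G *m v], a multiple
    of the squared norm of [G *m v], must vanish. *)
Lemma psd_quad_eq0 (R : realType) (n : nat) (G : 'M[R]_n) (v : 'cV[R]_n) :
  psd G -> quad G v = 0 -> G *m v = 0.
Proof.
case=> symG G_ge0 Gv0; apply: dot_eq0.
set a := (_ 0 0); pose b := quad G (G *m v).
have b_ge0 : 0 <= b by apply: G_ge0.
have b1_gt0 : 0 < b + 1 by lra.
(* The [+ 1] keeps the denominator of the step positive even when [b = 0]. *)
have := G_ge0 (v + (- a / (b + 1)) *: (G *m v)).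
rewrite quad_comb // Gv0 add0r -/a -/b.
have -> : 2 * (- a / (b + 1)) * a + (- a / (b + 1)) ^+ 2 * b =
          - (a / (b + 1)) ^+ 2 * (b + 2) by field; rewrite gt_eqF.
rewrite mulNr oppr_ge0 pmulr_lle0; last by lra.
move=> le0; have /eqP : (a / (b + 1)) ^+ 2 = 0.
  by apply/eqP; rewrite eq_le le0 sqr_ge0.
rewrite sqrf_eq0 mulf_eq0 invr_eq0 (gt_eqF b1_gt0) orbF.
by move/eqP.
Qed.

Lemma psdD (R : realType) (n : nat) (G H : 'M[R]_n) :
  psd G -> psd H -> psd (G + H).
Proof.
case=> sG G0 [sH H0]; split; first by rewrite linearD /= sG sH.
by move=> v; rewrite quadD addr_ge0.
Qed.

Lemma psd1 (R : realType) (n : nat) : psd (1%:M : 'M[R]_n).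
Proof. by split=> [|v]; rewrite ?trmx1 // quad1 dot_ge0. Qed.

Lemma psd_congr (R : realType) (n p : nat) (G : 'M[R]_n) (C : 'M[R]_(n, p)) :
  psd G -> psd (C^T *m G *m C).
Proof.
case=> sG G0; split; first by rewrite !trmx_mul trmxK sG mulmxA.
by move=> v; rewrite quad_congr.
Qed.

Lemma psd_add1_unit (R : realType) (n : nat) (G : 'M[R]_n) :
  psd G -> G + 1%:M \in unitmx.
Proof.
case=> sG G0; rewrite -row_free_unit -kermx_eq0; apply/eqP/row_matrixP => i.
rewrite row0; set k := row i _.
have kG : k *m (G + 1%:M) = 0 by rewrite -row_mul mulmx_ker row0.
suff k0 : k^T = 0 by rewrite -[LHS]trmxK k0 trmx0.
apply: dot_eq0; apply/eqP; rewrite eq_le dot_ge0 andbT.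
have : quad (G + 1%:M) k^T = 0 by rewrite /quad trmxK kG mul0mx mxE.
by rewrite quadD quad1 => <-; rewrite lerDr.
Qed.

(** * Riccati recursion and the matrix inequality *)

Section Lqr.
Variables (R : realType) (n m : nat) (A : 'M[R]_n) (B : 'M[R]_(n, m)).
Implicit Types (Q P : 'M[R]_n).

(** Gain of the feedback [u = K *m x] minimising [u^T *m u] plus [quad P] of the next state. *)
Definition riccati_gain P : 'M[R]_(m, n) :=
  - (invmx (B^T *m P *m B + 1%:M) *m (B^T *m P *m A)).

(* Joseph form of the Riccati step, in which positivity is manifest. *)
Definition riccati_step Q P : 'M[R]_n :=
  let K := riccati_gain P in
  (A + B *m K)^T *m P *m (A + B *m K) + K^T *m 1%:M *m K + Q.

(** The index counts steps back from the horizon: time [t] has [k = N - t]. *)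
Definition riccati Q k : 'M[R]_n := iter k (riccati_step Q) Q.

Lemma riccati_psd Q k : psd Q -> psd (riccati Q k).
Proof.
move=> psdQ; elim: k => //= k IHk.
by apply: psdD => //; apply: psdD; apply: psd_congr => //; apply: psd1.
Qed.

(* Completion of the square. *)
Lemma lmi_mx_riccati Q P : psd P ->
  lmi_mx A B Q (riccati_step Q P) P =
    (row_mx 1%:M (- riccati_gain P))^T *m (B^T *m P *m B + 1%:M)
      *m row_mx 1%:M (- riccati_gain P).
Proof.
move=> psdP; have [symP _] := psdP.
set K := riccati_gain P; set S := B^T *m P *m B + 1%:M.
have symS : S^T = S by rewrite /S linearD /= !trmx_mul trmxK symP trmx1 mulmxA.
have SK : S *m K = - (B^T *m P *m A).
  by rewrite mulmxN mulKVmx // psd_add1_unit //; apply: psd_congr.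
have KS : K^T *m S = - (A^T *m P *m B).
  by rewrite -[LHS]trmxK trmx_mul trmxK symS SK linearN /= !trmx_mul trmxK symP mulmxA.
rewrite /riccati_step -/K; clearbody K.
rewrite tr_row_mx mul_col_mx mul_col_row trmx1 !mul1mx !mulmx1.
rewrite [(- K)^T]linearN /= !(mulNmx, mulmxN) SK KS !(mulNmx, opprK) /lmi_mx -/S.
congr block_mx.
(* The lower right blocks of the two sides differ by exactly this vanishing term. *)
have : K^T *m (S *m K + B^T *m P *m A) = 0 by rewrite SK addNr mulmx0.
rewrite [(A + _)^T]linearD /= trmx_mul /S.
rewrite !(mulmxDl, mulmxDr, mulmxA) mulmx1 => K0.
rewrite -[RHS]subr0 -K0.
by apply/matrixP => i j; rewrite !mxE; ring.
Qed.

(** This is the Bellman slack of one step: stage cost plus next value minus present value. *)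
Lemma quad_lmi_mx Q P P' (x : 'cV[R]_n) (u : 'cV[R]_m) :
  quad (lmi_mx A B Q P P') (col_mx u x) =
    quad Q x + (u^T *m u) 0 0 + quad P' (A *m x + B *m u) - quad P x.
Proof.
rewrite /quad /lmi_mx tr_col_mx mul_row_block mul_row_col.
rewrite !linearD /= !trmx_mul.
rewrite !(mulmxDl, mulmxDr, mulmxN, mulNmx, mulmxA, mulmx1) !mxE.
by ring.
Qed.

(** The upper block row is stationarity in the input, the lower one the costate equation. *)
Lemma lmi_mx_mul0 Q P P' (x : 'cV[R]_n) (u : 'cV[R]_m) :
  lmi_mx A B Q P P' *m col_mx u x = 0 ->
  u = - (B^T *m P' *m (A *m x + B *m u)) /\
  P *m x = A^T *m P' *m (A *m x + B *m u) + Q *m x.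
Proof.
rewrite /lmi_mx mul_block_col => /eqP; rewrite col_mx_eq0 => /andP[/eqP h1 /eqP h2].
split; apply/eqP.
  rewrite -subr_eq0 opprK -h1 !(mulmxDl, mulmxDr, mulmxA) mul1mx.
  by apply/eqP/matrixP => i j; rewrite !mxE; ring.
rewrite eq_sym -subr_eq0 -h2 !(mulmxDl, mulmxDr, mulmxA, mulNmx).
by apply/eqP/matrixP => i j; rewrite !mxE; ring.
Qed.

Lemma lqr_cost_slack N Q (P : nat -> 'M[R]_n) x1
    (x : nat -> 'cV[R]_n) (u : nat -> 'cV[R]_m) :
  (0 < N)%N -> P N = Q -> lqr_feasible N A B x1 x u ->
  lqr_cost N Q x u = quad (P 1%N) x1 +
    \sum_(1 <= t < N) quad (lmi_mx A B Q (P t) (P t.+1)) (col_mx (u t) (x t)).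
Proof.
move=> N_gt0 PN [x1E xS].
have -> : \sum_(1 <= t < N) quad (lmi_mx A B Q (P t) (P t.+1)) (col_mx (u t) (x t))
  = \sum_(1 <= t < N) (quad Q (x t) + ((u t)^T *m u t) 0 0)
    + \sum_(1 <= t < N) (quad (P t.+1) (x t.+1) - quad (P t) (x t)).
  rewrite -big_split /=; apply: eq_big_nat => t tN.
  by rewrite quad_lmi_mx -xS // addrA.
rewrite telescope_sumr // PN x1E /lqr_cost.
by ring.
Qed.

(** The Riccati feedback makes every slack zero, so its cost equals the right-hand side and bounds
    the optimal cost. *)
Lemma riccati_optimal N Q x1 (x : nat -> 'cV[R]_n) (u : nat -> 'cV[R]_m) :
  (0 < N)%N -> psd Q -> lqr_optimal N A B Q x1 x u ->
  lqr_cost N Q x u <= quad (riccati Q (N - 1)) x1.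
Proof.
move=> N_gt0 psdQ [_ opt].
pose P t := riccati Q (N - t).
pose K t := riccati_gain (P t.+1).
(* [z] starts at index 0 but time at 1, hence the gain [K s.+1] and the shift [t.-1] below. *)
pose fix z t := if t is s.+1 then (A + B *m K s.+1) *m z s else x1.
pose x' t := z t.-1; pose u' t := K t *m x' t.
have feas : lqr_feasible N A B x1 x' u'.
  split=> // -[|t] // _; rewrite /x' /u' /=.
  by rewrite mulmxDl mulmxA.
apply: (le_trans (opt _ _ feas)).
rewrite (lqr_cost_slack (P := P) N_gt0 _ feas); last by rewrite /P subnn.
rewrite [X in _ + X]big_nat big1 ?addr0 // => t /andP[t_gt0 tN].
rewrite {1}/P -(subnSK tN) /= lmi_mx_riccati; last exact: riccati_psd.
by rewrite quad_congr mul_row_col mul1mx mulNmx subrr /quad mulmx0 mxE.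
Qed.

Lemma riccati_domain N Q :
  psd Q -> domain N A B Q (fun t => riccati Q (N - t)).
Proof.
move=> psdQ; split=> //; first by move=> t _; apply: riccati_psd.
  by rewrite subnn.
move=> t /andP[_ tN]; rewrite -(subnSK tN) /= lmi_mx_riccati; last exact: riccati_psd.
apply: psd_congr; apply: psdD (@psd1 R m); apply: psd_congr; exact: riccati_psd.
Qed.

(* Unrolling the recursion, [d k] is the sum of [y (k - j) *m D *m A ^+ j]. *)
Lemma costate_markov0 M K (D : 'M[R]_n) (y d : nat -> 'M[R]_(M, n)) :
  row_full (y 0%N) -> d 0%N = y 0%N *m D ->
  (forall k, (k.+1 < K)%N -> d k.+1 = d k *m A + y k.+1 *m D) ->
  (forall k, (k < K)%N -> d k *m B = 0) ->
  forall k, (k < K)%N -> D *m (A ^+ k *m B) = 0.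
Proof.
move=> y0_full d0 dS dB.
have dE k : (k < K)%N -> d k = \sum_(j < k.+1) y (k - j)%N *m D *m A ^+ j.
  elim: k => [_|k IHk kK]; first by rewrite big_ord1 d0 expr0 mulmx1.
  rewrite dS // IHk ?(ltnW kK) // [RHS]big_ord_recl /= subn0 expr0 mulmx1 addrC.
  congr (_ + _); rewrite mulmx_suml; apply: eq_bigr => j _.
  by rewrite exprSr -mulmxA.
(* By strong induction only the term [j = k] of [d k *m B] survives; its factor [y 0] cancels. *)
elim/ltn_ind => k IHk kK.
have := dB _ kK; rewrite dE // big_ord_recr /= mulmxDl subnn mulmx_suml big1 => [|j _].
  rewrite add0r => y0D; apply: (row_full_inj y0_full).
  by rewrite mulmx0 -y0D !mulmxA.
by rewrite -!mulmxA IHk ?mulmx0 // (ltn_trans _ kK).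
Qed.

Lemma controllable_markov0 (D : 'M[R]_n) : controllable A B ->
  (forall k, (k < n)%N -> D *m (A ^+ k *m B) = 0) -> D = 0.
Proof.
move=> ctrl DAB; apply/eqP.
rewrite -(mulmx_free_eq0 _ (_ : row_free (\mxrow_(k < n) (A ^+ k *m B)))).
  by rewrite mul_mxrow (eq_mxrow (fun k => DAB k (ltn_ord k))) mxrow0.
by rewrite /row_free ctrl.
Qed.

End Lqr.

(** * Observation matrices and the objective *)

Lemma col_mulmx (R : realType) (n p q : nat) (A : 'M[R]_(n, p)) (B : 'M_(p, q)) j :
  col j (A *m B) = A *m col j B.
Proof. by rewrite !colE mulmxA. Qed.

Lemma col_matrixP (R : realType) (n p : nat) (A B : 'M[R]_(n, p)) :
  (forall j, col j A = col j B) -> A = B.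
Proof. by move=> AB; apply/matrixP => i j; have /colP/(_ i) := AB j; rewrite !mxE. Qed.

Lemma gram_posdef_row_free (R : realType) (n p : nat) (Y : 'M[R]_(n, p)) :
  posdef (Y *m Y^T) -> row_free Y.
Proof.
case=> _ Ygt0; rewrite -kermx_eq0; apply/eqP/row_matrixP => i; rewrite row0.
set k := row i _; have kY : k *m Y = 0 by rewrite -row_mul mulmx_ker row0.
apply/eqP; rewrite -trmx_eq0; apply: contraT => /Ygt0.
by rewrite /quad trmxK mulmxA kY !mul0mx mxE ltxx.
Qed.

Lemma col_observations (R : realType) (n M : nat)
    (x : 'I_M -> nat -> 'cV[R]_n) (phi : nat -> 'S_M) t j :
  col j (observations x phi t) = x (phi t j) t.
Proof. by apply/colP => i; rewrite !mxE. Qed.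

(* The trace only sees the columns as an unordered family, so the unknown
   permutations disappear. *)
Lemma trace_observations (R : realType) (n M : nat) (G : 'M[R]_n)
    (x : 'I_M -> nat -> 'cV[R]_n) (phi : nat -> 'S_M) t :
  \tr (G *m observations x phi t *m (observations x phi t)^T) =
    \sum_i quad G (x i t).
Proof.
rewrite mxtrace_mulC /mxtrace [RHS](reindex_inj (@perm_inj _ (phi t))) /=.
apply: eq_bigr => j _.
rewrite -(col_observations x phi) /quad tr_col -mulmxA -col_mulmx.
by rewrite mxE [RHS]mxE; apply: eq_bigr => i _; rewrite !mxE.
Qed.

(** Adding and subtracting the input energy completes the state terms to LQR costs. *)
Lemma objective_slack (R : realType) (n m M N : nat)
    (A : 'M[R]_n) (B : 'M[R]_(n, m)) (xbar : 'I_M -> 'cV[R]_n)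
    (x : 'I_M -> nat -> 'cV[R]_n) (u : 'I_M -> nat -> 'cV[R]_m)
    (phi : nat -> 'S_M) Q P :
  (forall i, lqr_feasible N A B (xbar i) (x i) (u i)) -> P N = Q ->
  objective N (observations x phi) Q P =
    \sum_i (lqr_cost N Q (x i) (u i) - quad (P 1%N) (xbar i))
    - \sum_i \sum_(1 <= t < N) ((u i t)^T *m u i t) 0 0.
Proof.
move=> feas PN; rewrite /objective !trace_observations.
rewrite (eq_bigr _ (fun t _ => trace_observations Q x phi t)).
rewrite exchange_big /= -sumrN -!big_split /= -sumrB; apply: eq_bigr => i _.
by rewrite /lqr_cost big_split /= PN (feas i).1; ring.
Qed.

(** * Consequences of attaining the lower bound *)

Section Data.
Variables (R : realType) (n m M N : nat) (A : 'M[R]_n) (B : 'M[R]_(n, m)).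
Variables (xbar : 'I_M -> 'cV[R]_n).
Variables (x : 'I_M -> nat -> 'cV[R]_n) (u : 'I_M -> nat -> 'cV[R]_m).
Hypothesis feas : forall i, lqr_feasible N A B (xbar i) (x i) (u i).

(* The sum of the squared norms of the inputs bounds [- objective] from above by
   nonnegativity of the LMI; on equality the LMI degenerates along the data, which
   is the costate recursion of the Pontryagin principle. *)
Lemma costate_of_tight Q P phi :
  (0 < N)%N -> domain N A B Q P ->
  objective N (observations x phi) Q P <=
    - \sum_i \sum_(1 <= t < N) ((u i t)^T *m u i t) 0 0 ->
  forall i t, (1 <= t < N)%N ->
    u i t = - (B^T *m P t.+1 *m x i t.+1) /\
    P t *m x i t = A^T *m P t.+1 *m x i t.+1 + Q *m x i t.
Proof.
move=> N_gt0 [psdQ psdP PN lmiP] obj_le i t tN.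
have slack_ge0 j s : (1 <= s < N)%N ->
    0 <= quad (lmi_mx A B Q (P s) (P s.+1)) (col_mx (u j s) (x j s)).
  by move=> sN; have [_] := lmiP s sN; apply.
have sum_ge0 j :
    0 <= \sum_(1 <= s < N) quad (lmi_mx A B Q (P s) (P s.+1)) (col_mx (u j s) (x j s)).
  by rewrite big_nat; apply: sumr_ge0 => s sN; apply: slack_ge0.
move: obj_le; rewrite (objective_slack phi feas PN) gerDr => obj_le.
have /eqP : \sum_j \sum_(1 <= s < N)
    quad (lmi_mx A B Q (P s) (P s.+1)) (col_mx (u j s) (x j s)) = 0.
  apply/eqP; rewrite eq_le sumr_ge0 // andbT.
  apply: le_trans obj_le; apply: ler_sum => j _.
  by rewrite (lqr_cost_slack N_gt0 PN (feas j)) addrC addKr.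
rewrite psumr_eq0 // => /allP/(_ i (mem_index_enum i)); rewrite implyTb.
rewrite big_nat psumr_eq0; last by move=> s sN; apply: slack_ge0.
move=> /allP/(_ t); rewrite mem_index_iota tN => /(_ isT) /eqP /psd_quad_eq0.
by move/(_ (lmiP t tN))/lmi_mx_mul0; rewrite -(feas i).2.
Qed.

(* [x_(t+1) = A x_t + B u_t] and [u_t = - B^T P_(t+1) x_(t+1)] give
   [(1 + B B^T P_(t+1)) x_(t+1) = A x_t] with [A] invertible. *)
Lemma observations_row_free (P : nat -> 'M[R]_n) :
  A \in unitmx ->
  (forall i t, (1 <= t < N)%N -> u i t = - (B^T *m P t.+1 *m x i t.+1)) ->
  row_free (observations x (fun=> 1%g) 1) ->
  forall t, (1 <= t <= N)%N -> row_free (observations x (fun=> 1%g) t).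
Proof.
move=> Aunit uE X1 [//|t]; elim: t => [//|t IHt] /= tN.
have {IHt} /eqP Xt : row_free (observations x (fun=> 1%g) t.+1) by apply/IHt/ltnW.
rewrite /row_free eqn_leq rank_leq_row /= -[X in (X <= _)%N]Xt.
rewrite -(eqmxMfull (observations x (fun=> 1%g) t.+1) (_ : row_full A)); last first.
  by rewrite row_full_unit.
have -> : A *m observations x (fun=> 1%g) t.+1 =
    (1%:M + B *m B^T *m P t.+2) *m observations x (fun=> 1%g) t.+2.
  apply: col_matrixP => j; rewrite !col_mulmx !col_observations.
  rewrite perm1 [in RHS]mulmxDl mul1mx {1}((feas j).2 t.+1) // uE // mulmxN !mulmxA.
  by rewrite subrK.
exact: mxrankM_maxr.
Qed.

End Data.

(** * Comparison of the two costates *)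

Theorem theorem3p1 (R : realType) (n m M N : nat)
    (A : 'M[R]_n) (B : 'M[R]_(n, m)) (Qbar : 'M[R]_n)
    (hA : A \in unitmx) (hB : \rank B = m) (hAB : controllable A B)
    (hQbar : psd Qbar)
    (xbar : 'I_M -> 'cV[R]_n)
    (x : 'I_M -> nat -> 'cV[R]_n) (u : 'I_M -> nat -> 'cV[R]_m)
    (hxu : forall i : 'I_M, lqr_optimal N A B Qbar (xbar i) (x i) (u i))
    (phi : nat -> 'S_M) (hphi1 : phi 1%N = 1%g)
    (hN : (n + 1 <= N)%N)
    (hY1 : posdef (observations x phi 1 *m (observations x phi 1)^T))
    (Qstar : 'M[R]_n) (Pstar : nat -> 'M[R]_n)
    (hopt : optimal_solution N A B (observations x phi) Qstar Pstar) :
  Qstar = Qbar.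
Proof.
have N_gt0 : (0 < N)%N by apply: leq_trans hN; rewrite addn1.
have feas i : lqr_feasible N A B (xbar i) (x i) (u i) by case: (hxu i).
have [domS minS] := hopt.
pose Pbar t := riccati A B Qbar (N - t).
have domB : domain N A B Qbar Pbar by apply: riccati_domain.
have objB : objective N (observations x phi) Qbar Pbar <=
    - \sum_i \sum_(1 <= t < N) ((u i t)^T *m u i t) 0 0.
  have [_ _ PbarN _] := domB; rewrite (objective_slack phi feas PbarN) gerDr.
  by apply: sumr_le0 => i _; rewrite subr_le0; apply: riccati_optimal.
have costB := costate_of_tight feas N_gt0 domB objB.
have costS := costate_of_tight feas N_gt0 domS (le_trans (minS _ _ domB) objB).
have [[symQS _] psdS PSN _] := domS; have [[symQB _] psdB PBN _] := domB.
pose D := Qstar - Qbar; pose DP t := Pstar t - Pbar t.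
have symDP t : (1 <= t <= N)%N -> (DP t)^T = DP t.
  by move=> tN; rewrite linearB /= (psdS t tN).1 (psdB t tN).1.
have symD : D^T = D by rewrite linearB /= symQS symQB.
(* The costate relations hold agent by agent, so the states may be listed unpermuted. [y] runs
   backwards, since the costates are known at time [N]. *)
pose X := observations x (fun=> 1%g); pose y k := (X (N - k)%N)^T.
have colX j t : col j (X t) = x j t by rewrite col_observations perm1.
have y0_full : row_full (y 0%N).
  rewrite /row_full mxrank_tr subn0.
  apply: (observations_row_free feas hA (fun i t tN => (costB i t tN).1)) => //.
    suff -> : observations x (fun=> 1%g) 1 = observations x phi 1.
      exact: gram_posdef_row_free.
    by apply/matrixP => i j; rewrite !mxE hphi1.
  by rewrite N_gt0 leqnn.
apply/eqP; rewrite -subr_eq0 -/D; apply/eqP.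
apply: (controllable_markov0 hAB) => k kn.
pose d k := y k *m DP (N - k)%N.
(* The [N - 1] transitions cover all [n] powers of [A] in the Kalman matrix. *)
have kN : (k < N.-1)%N by rewrite -ltnS prednK // (leq_trans _ hN) // addn1.
apply: (costate_markov0 (d := d) y0_full _ _ _ kN).
- by rewrite /d subn0 /DP PSN PBN.
(* Difference of the two costate equations at time [N - k.+1], transposed and read column by
   column. *)
- move=> {kn kN} {}k kN; rewrite /d; have kN' : (1 <= N - k.+1 < N)%N by lia.
  have NkS : (N - k.+1).+1 = (N - k)%N by lia.
  rewrite -NkS /y -NkS; move: (N - k.+1)%N kN' => t tN {NkS}.
  apply: (can_inj (@trmxK _ _ _)); apply: col_matrixP => j.
  rewrite [(_ *m _ + _)^T]linearD /= !trmx_mul !trmxK symD !symDP; try lia.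
  rewrite [col _ (_ *m _ + _)]linearD /= !col_mulmx !colX /DP /D !mulmxBl.
  have [_ ->] := costB j t tN; have [_ ->] := costS j t tN.
  by rewrite mulmxBr !mulmxA opprD addrACA.
(* Both costates produce the same input, so [B^T] annihilates their difference. *)
- move=> {kn kN} {}k kN; rewrite /d.
  have NkS : (N - k.+1).+1 = (N - k)%N by lia.
  have tN : (1 <= N - k.+1 < N)%N by lia.
  rewrite /y -NkS; move: (N - k.+1)%N tN => t tN {NkS}.
  apply: (can_inj (@trmxK _ _ _)); apply: col_matrixP => j.
  rewrite trmx0 !trmx_mul trmxK symDP; last by lia.
  rewrite !col_mulmx colX col0 /DP mulmxBl mulmxBr !mulmxA.
  have [uB _] := costB j t tN; have [uS _] := costS j t tN.
  by apply/eqP; rewrite subr_eq0 -eqr_opp -uB -uS.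
Qed.
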